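(* Let $K$ be a number field and let $D\subset\mathbb{P}^3_K$ be the closed subvariety \[ D = H_1\cup H_2\cup H_3\cup H_4\cup L_1\cup\dots\cup L_r, \] where $H_1,\dots,H_4$ are planes defined over $K$ in general position and $L_1,\dots,L_r$ are lines defined over $K$ all passing through a common $K$-rational point $p$. Suppose that none of $L_1,\dots,L_r$ intersects any of the six lines $H_i\cap H_j$, $1\le i<j\le 4$. Then the integral points on $\mathbb{P}^3_K\setminus D$ are potentially dense.
   Context: Let $K$ be a number field and $S$ a finite set of places of $K$ containing all archimedean places; $\mathcal{O}_S=\{x\in K: v(x)\ge 0 \text{ for all finite } v\notin S\}$. For a finite place $v$, $\mathcal{O}_v$ is the valuation ring, $\mathfrak{m}_v$ its maximal ideal and $k_v$ its residue field. Reduction: for a closed subvariety $Z\subset\mathbb{P}^n_K$ with radical homogeneous ideal $I\subset K[X_0,\dots,X_n]$, $Z_v\subset\mathbb{P}^n_{k_v}$ is the zero set of the image of $I\cap\mathcal{O}_v[X_0,\dots,X_n]$ in $k_v[X_0,\dots,X_n]$. For $x\in\mathbb{P}^n(K)$, $x_v\in\mathbb{P}^n(k_v)$ is its reduction; $x$ reduces to $Z$ at $v$ if $x_v\in Z_v$. For a projective $X\subset\mathbb{P}^n_K$ and a proper closed subvariety $D\subset X$, $x\in X(K)$ is an $S$-integral point of $X\setminus D$ if for every finite place $v\notin S$, $x$ does not reduce to $D$ at $v$; the set of these is $(X\setminus D)(\mathcal{O}_S)$. The integral points on $X\setminus D$ are potentially dense if there exist a finite extension $K'/K$ and a finite set $S'$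 of places of $K'$ containing all places above those of $S$ such that $(X\setminus D)(\mathcal{O}_{S'})$, computed over $K'$, is Zariski dense in $X_{K'}$. *)

(* Defs.v *)
From HB Require Import structures.
From mathcomp Require Import all_boot all_order all_algebra all_field.
From mathcomp Require Import mpoly.
Set Implicit Arguments. Unset Strict Implicit. Unset Printing Implicit Defensive.
Import Order.TTheory GRing.Theory Num.Theory.
Local Open Scope ring_scope.

(* A number field is a [fieldExtType rat] (finite-dimensional field over Q).
   Points of P^3 are represented by nonzero coordinate vectors 'I_4 -> K
   (all notions below are invariant under nonzero scaling). *)

Definition nzvec (K : fieldType) (x : 'I_4 -> K) : Prop := exists i, x i != 0.

Definition linform (K : fieldType) (h : 'I_4 -> K) : {mpoly K[4]} :=
  \sum_(i < 4) h i *: 'X_i.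

Definition linval (K : fieldType) (h x : 'I_4 -> K) : K := \sum_(i < 4) h i * x i.

(* Finite places of a number field K: normalized discrete valuations
   v : K^* ->> Z (with the convention v 0 = 0). *)
Definition is_dval (K : fieldType) (v : K -> int) : Prop :=
  [/\ v 0 = 0,
      (forall x y, x != 0 -> y != 0 -> v (x * y) = v x + v y),
      (forall x y, x != 0 -> y != 0 -> x + y != 0 ->
          Num.min (v x) (v y) <= v (x + y))
    & exists x, v x = 1].

Definition vint (K : fieldType) (v : K -> int) (c : K) : Prop := c = 0 \/ 0 <= v c.
Definition vpos (K : fieldType) (v : K -> int) (c : K) : Prop := c = 0 \/ 0 < v c.

Definition vnormalized (K : fieldType) (v : K -> int) (y : 'I_4 -> K) : Prop :=
  (forall i, vint v (y i)) /\ exists i, y i != 0 /\ v (y i) = 0.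

(* x reduces at v to the zero set of the (homogeneous radical) ideal I:
   x_v lies in the zero set of the image of I ∩ O_v[X] in k_v[X]. *)
Definition reduces_to (K : fieldType) (v : K -> int)
    (I : {mpoly K[4]} -> Prop) (x : 'I_4 -> K) : Prop :=
  forall y : 'I_4 -> K, (exists c, c != 0 /\ forall i, y i = c * x i) ->
    vnormalized v y ->
    forall f, I f -> (forall m, vint v f@_m) -> vpos v f.@[y].

(* Radical homogeneous ideal of D = H_1 ∪ ... ∪ H_4 ∪ L_1 ∪ ... ∪ L_r:
   intersection of the prime ideals (h_i) and (a_j, b_j). *)
Definition D_ideal (K : fieldType) (hs : 'I_4 -> 'I_4 -> K)
    (r : nat) (ls : 'I_r -> ('I_4 -> K) * ('I_4 -> K)) (f : {mpoly K[4]}) : Prop :=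
  (forall i, exists g, f = g * linform (hs i)) /\
  (forall j, exists g1 g2, f = g1 * linform (ls j).1 + g2 * linform (ls j).2).

Definition lies_above (K L : fieldType) (iota : {rmorphism K -> L})
    (w : L -> int) (v : K -> int) : Prop :=
  exists e : nat, (0 < e)%N /\ forall x, x != 0 -> w (iota x) = e%:Z * v x.

(* S-integral points of P^3 \ D over L, S given by finitely many finite places
   (the archimedean places are implicitly in S) *)
Definition S_integral (L : fieldType) (n : nat) (S : 'I_n -> L -> int)
    (I : {mpoly L[4]} -> Prop) (x : 'I_4 -> L) : Prop :=
  nzvec x /\ forall w, is_dval w -> (forall k, S k <> w) -> ~ reduces_to w I x.

(* Zariski density in P^3_L of a (scaling-invariant) set of points A:
   only the zero polynomial vanishes on all representatives. *)
Definition zariski_dense (L : fieldType) (A : ('I_4 -> L) -> Prop) : Prop :=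
  forall p : {mpoly L[4]}, (forall x, A x -> p.@[x] = 0) -> p = 0.

Definition potentially_dense (K : fieldExtType rat) (nS : nat) (S : 'I_nS -> K -> int)
    (hs : 'I_4 -> 'I_4 -> K) (r : nat) (ls : 'I_r -> ('I_4 -> K) * ('I_4 -> K)) : Prop :=
  exists (L : fieldExtType rat) (iota : {rmorphism K -> L})
         (nS' : nat) (S' : 'I_nS' -> L -> int),
    (forall k, is_dval (S' k)) /\
    (forall k w, is_dval w -> lies_above iota w (S k) -> exists k', S' k' = w) /\
    zariski_dense (S_integral S'
       (D_ideal (fun i j => iota (hs i j)) (fun j => (iota \o (ls j).1, iota \o (ls j).2)))).

(* Main.v *)
Require Import Defs.
From Stdlib Require Import Classical FunctionalExtensionality.
From HB Require Import structures.
From mathcomp Require Import all_boot all_order all_algebra all_field.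
From mathcomp Require Import mpoly perm ring zify.
From mathcomp Require cyclic.
Import Order.TTheory GRing.Theory Num.Theory.
Local Open Scope ring_scope.
Set Implicit Arguments. Unset Strict Implicit. Unset Printing Implicit Defensive.

(* Let y_i = h_i(x), and let q be the point p in these coordinates; at most one
   coordinate of q vanishes, say only q_0 may.  No extension of K is needed: put
   into S all places above 2 and those where one of finitely many constants
   attached to the data is not a unit.  Fix a constant e different from 0 and q_0,
   let t = 2^a, u = 2^(Mn), and consider
     y = (e t^b, q_1 u, q_2 t, q_3),
   which is integral with respect to the four planes.  On a line L through p, let
   A and B be the linear forms vanishing on L in which y_1, respectively y_0, has
   been eliminated.  At a place dividing t - 1, A(y) is congruent to a unit
   multiple of e - q_0.  At any other place, if A(y) is not a unit, it suffices to
   have u = 1 there for B(y) to be congruent to a unit multiple of t - 1; this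
   is achieved by choosing M, after a and b, with 2^M = 1 modulo all places
   outside S dividing A(y), which does not involve u.  So y never reduces to L.
   Density follows by letting n, b, a and a scaling factor vary in this order. *)

(** * Arithmetic of integral, positive and unit elements at a place *)

Section Dval.
Context (K : fieldType) (v : K -> int) (hv : is_dval v).

Lemma dval0 : v 0 = 0. Proof. by case: hv. Qed.

Lemma dvalM x y : x != 0 -> y != 0 -> v (x * y) = v x + v y.
Proof. by case: hv => _ hM _ _; apply: hM. Qed.

Lemma dval1 : v 1 = 0.
Proof. by have := dvalM (oner_neq0 K) (oner_neq0 K); rewrite mulr1; move: (v 1) => z; lia. Qed.

Lemma dvalX x n : x != 0 -> v (x ^+ n) = n%:Z * v x.
Proof.
move=> x0; elim: n => [|n IH]; first by rewrite expr0 dval1 mul0r.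
by rewrite exprS dvalM ?expf_neq0 // IH; lia.
Qed.

Lemma dvalV x : v x^-1 = - v x.
Proof.
have [->|x0] := eqVneq x 0; first by rewrite invr0 dval0 oppr0.
have := dvalM (x := x) (y := x^-1) x0; rewrite invr_eq0 => /(_ x0).
by rewrite divff // dval1; lia.
Qed.

Lemma dvalN x : v (- x) = v x.
Proof.
have [->|x0] := eqVneq x 0; first by rewrite oppr0.
have n1 : (-1 : K) != 0 by rewrite oppr_eq0 oner_neq0.
have := dvalM n1 n1; rewrite mulrNN mulr1 dval1 => h.
by rewrite -mulN1r dvalM //; lia.
Qed.

Lemma vint0 : vint v 0. Proof. by left. Qed.
Lemma vint1 : vint v 1. Proof. by right; rewrite dval1. Qed.

Lemma vposW x : vpos v x -> vint v x.
Proof. by case=> [->|/ltW]; [left|right]. Qed.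

Lemma vintD x y : vint v x -> vint v y -> vint v (x + y).
Proof.
have [->|x0] := eqVneq x 0; first by rewrite add0r.
have [->|y0] := eqVneq y 0; first by rewrite addr0.
have [->|xy0] := eqVneq (x + y) 0; first by left.
case=> [xE|vx]; first by rewrite xE eqxx in x0.
case=> [yE|vy]; first by rewrite yE eqxx in y0.
right; case: hv => _ _ /(_ _ _ x0 y0 xy0) h _.
by apply: le_trans h; rewrite le_min vx vy.
Qed.

Lemma vposD x y : vpos v x -> vpos v y -> vpos v (x + y).
Proof.
have [->|x0] := eqVneq x 0; first by rewrite add0r.
have [->|y0] := eqVneq y 0; first by rewrite addr0.
have [->|xy0] := eqVneq (x + y) 0; first by left.
case=> [xE|vx]; first by rewrite xE eqxx in x0.
case=> [yE|vy]; first by rewrite yE eqxx in y0.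
right; case: hv => _ _ /(_ _ _ x0 y0 xy0) h _.
by apply: lt_le_trans h; rewrite lt_min vx vy.
Qed.

Lemma vintM x y : vint v x -> vint v y -> vint v (x * y).
Proof.
have [->|x0] := eqVneq x 0; first by rewrite mul0r.
have [->|y0] := eqVneq y 0; first by rewrite mulr0.
case=> [xE|vx]; first by rewrite xE eqxx in x0.
case=> [yE|vy]; first by rewrite yE eqxx in y0.
by right; rewrite dvalM // addr_ge0.
Qed.

Lemma vposM x y : vpos v x -> vint v y -> vpos v (x * y).
Proof.
have [->|x0] := eqVneq x 0; first by rewrite mul0r.
have [->|y0] := eqVneq y 0; first by rewrite mulr0; left.
case=> [xE|vx]; first by rewrite xE eqxx in x0.
case=> [yE|vy]; first by rewrite yE eqxx in y0.
by right; rewrite dvalM // ltr_wpDr.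
Qed.

Lemma vintN x : vint v x -> vint v (- x).
Proof. by case=> [->|vx]; [left; rewrite oppr0 | right; rewrite dvalN]. Qed.

Lemma vposN x : vpos v x -> vpos v (- x).
Proof. by case=> [->|vx]; [left; rewrite oppr0 | right; rewrite dvalN]. Qed.

Lemma vintX x n : vint v x -> vint v (x ^+ n).
Proof.
move=> vx; elim: n => [|n IH]; first exact: vint1.
by rewrite exprS; apply: vintM.
Qed.

Lemma vint_sum I (s : seq I) (P : pred I) F :
  (forall i, P i -> vint v (F i)) -> vint v (\sum_(i <- s | P i) F i).
Proof. by move=> h; apply: big_ind => //; [left | exact: vintD]. Qed.

Lemma vpos_sum I (s : seq I) (P : pred I) F :
  (forall i, P i -> vpos v (F i)) -> vpos v (\sum_(i <- s | P i) F i).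
Proof. by move=> h; apply: big_ind => //; [left | exact: vposD]. Qed.

Lemma vint_prod I (s : seq I) (P : pred I) F :
  (forall i, P i -> vint v (F i)) -> vint v (\prod_(i <- s | P i) F i).
Proof. by move=> h; apply: big_ind => //; [apply: vint1 | exact: vintM]. Qed.

Lemma vintB x y : vint v x -> vint v y -> vint v (x - y).
Proof. by move=> vx vy; apply: vintD => //; apply: vintN. Qed.

Lemma vint_nat n : vint v n%:R.
Proof. by elim: n => [|n IH]; rewrite ?mulrSr; [exact: vint0 | apply: vintD IH vint1]. Qed.

Lemma vint_int n : vint v n%:~R.
Proof.
by case: n => n; rewrite ?NegzE ?mulrNz; [|apply: vintN]; apply: vint_nat.
Qed.

(** Nonvanishing is a separate clause because [v 0 = 0] by convention. *)
Definition vunit (c : K) := c != 0 /\ v c = 0.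

Lemma vunit_int c : vunit c -> vint v c.
Proof. by case=> _ vc; right; rewrite vc. Qed.

Lemma vunitNpos c : vunit c -> ~ vpos v c.
Proof. by case=> c0 vc [cE|]; [rewrite cE eqxx in c0 | rewrite vc]. Qed.

Lemma vint_unit c : vint v c -> ~ vpos v c -> vunit c.
Proof.
move=> vc npc; have c0 : c != 0 by apply/eqP => cE; apply: npc; left.
split=> //; case: vc => [cE|vc]; first by rewrite cE eqxx in c0.
have [//|v0] := eqVneq (v c) 0.
by case: npc; right; rewrite lt_neqAle eq_sym v0.
Qed.

Lemma vunitM c d : vunit c -> vunit d -> vunit (c * d).
Proof. by case=> c0 vc [d0 vd]; split; rewrite ?mulf_neq0 // dvalM // vc vd. Qed.

Lemma vunitX c n : vunit c -> vunit (c ^+ n).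
Proof. by case=> c0 vc; split; rewrite ?expf_neq0 // dvalX // vc mulr0. Qed.

Lemma vunit_prod I (s : seq I) (P : pred I) F :
  (forall i, P i -> vunit (F i)) -> vunit (\prod_(i <- s | P i) F i).
Proof.
move=> h; apply: big_ind => //; last exact: vunitM.
by split; [apply: oner_neq0 | apply: dval1].
Qed.

Lemma vunitD c d : vunit c -> vpos v d -> vunit (c + d).
Proof.
move=> uc pd; apply: vint_unit; first exact: vintD (vunit_int uc) (vposW pd).
move=> pcd; apply: (vunitNpos uc).
by rewrite -(addrK d c); apply: vposD => //; apply: vposN.
Qed.

Lemma vposMV c d : vunit c -> vpos v (c * d) -> vpos v d.
Proof.
case=> c0 vc pcd; rewrite -(mulKf c0 d) mulrC; apply: vposM => //.
by right; rewrite dvalV vc oppr0.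
Qed.

Lemma vpos_subX1 x n : vint v x -> vpos v (x - 1) -> vpos v (x ^+ n - 1).
Proof.
move=> vx px; rewrite subrX1; apply: vposM => //.
by apply: vint_sum => i _; apply: vintX.
Qed.

End Dval.

(** * Rational integers and integer polynomials in a number field *)

Lemma natf_eq (K : fieldExtType rat) m n : ((m%:R : K) == n%:R) = (m == n).
Proof. by rewrite -!(rmorph_nat (in_alg K)) (inj_eq (fmorph_inj (in_alg K))) eqr_nat. Qed.

Lemma intf_neq0 (K : fieldExtType rat) n : ((n%:~R : K) == 0) = (n == 0).
Proof. by rewrite -(rmorph_int (in_alg K)) fmorph_eq0 intr_eq0. Qed.

(** Clear denominators in the minimal polynomial of [x] over Q and divide by the highest power of X;
    as [x != 0], it remains a root. *)
Lemma int_poly_root (K : fieldExtType rat) (x : K) : x != 0 ->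
  exists q : {poly int}, q`_0 != 0 /\ root (map_poly intr q) x.
Proof.
move=> x0.
have /polyOver1P[p pE] := minPolyOver 1%AS x.
have [q [a a0 qE]] := rat_poly_scale p.
have rx : root (map_poly intr q) x.
  have := root_minPoly 1%AS x; rewrite pE qE.
  rewrite map_polyZ /= rootZ ?(fmorph_eq0 (in_alg K)) ?invr_eq0 ?intr_eq0 //.
  rewrite -map_poly_comp /=; congr (root _ _); apply: eq_map_poly => i /=.
  by rewrite -(rmorph_int (in_alg K)).
have q0 : q != 0.
  apply/eqP => q0; have := monic_minPoly 1%AS x.
  by rewrite pE qE q0 map_poly0 scaler0 map_poly0 monicE lead_coef0 eq_sym oner_eq0.
have [m [s rs qs]] := multiplicity_XsubC q 0; rewrite q0 /= in rs.
exists s; split; first by rewrite -horner_coef0.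
move: rx; rewrite qs rmorphM rmorphXn /= rootM => /orP[//|].
rewrite rmorphB /= map_polyX map_polyC /= subr0 /root hornerXn.
by rewrite expf_eq0 (negPf x0) andbF.
Qed.

(** In an integer equation for [x], the constant term is [x] times a polynomial in [x] with integer
    coefficients, hence positive wherever [x] is. *)
Lemma dval_pos_nat (K : fieldExtType rat) (x : K) : x != 0 ->
  exists2 n : nat, (0 < n)%N & forall w, is_dval w -> vpos w x -> vpos w n%:R.
Proof.
move=> x0; have [q [q0 rx]] := int_poly_root x0.
exists `|(q`_0)%R|%N => [|w hw px]; first by rewrite absz_gt0.
have pq : vpos w (q`_0)%:~R.
  move: rx; rewrite /root horner_coef.
  case sz : (size _) => [|n].
    move/eqP: sz; rewrite size_poly_eq0 => /eqP q00.
    have := congr1 (fun r : {poly K} => r`_0) q00; rewrite coef_map coef0 /=.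
    by move/eqP; rewrite intf_neq0 (negPf q0).
  rewrite big_ord_recl expr0 mulr1 coef_map /= addrC addr_eq0 => /eqP E.
  rewrite -[X in vpos _ X]opprK -E; apply: vposN => //; apply: vpos_sum => // i _.
  rewrite coef_map /= exprS mulrCA; apply: vposM => //; apply: vintM => //.
    exact: vint_int.
  by apply: vintX => //; apply: vposW.
by move: pq; case: (q`_0) => n; rewrite // NegzE mulrNz => /(vposN hw); rewrite opprK.
Qed.

(** * Independence of finite places and approximation *)

(** Units at [v] are units at [w], so [w] is [w pi] times [v] for a uniformizer [pi] of [v]; since
    [w] also takes the value 1, this factor is 1. *)
Lemma dval_le_eq (K : fieldType) (v w : K -> int) :
  is_dval v -> is_dval w -> (forall x, 0 <= v x -> 0 <= w x) -> v = w.
Proof.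
move=> hv hw hvw.
have eq0 x : v x = 0 -> w x = 0.
  move=> vx; have := hvw x; have := hvw x^-1.
  by rewrite !dvalV // vx oppr0 lexx => /(_ isT) ? /(_ isT) ?; lia.
have [pi vpi] : exists x, v x = 1 by case: hv.
have [rho wrho] : exists x, w x = 1 by case: hw.
have pi0 : pi != 0 by apply/eqP => E; move: vpi; rewrite E dval0.
have wE x : x != 0 -> w x = v x * w pi.
  move=> x0.
  have key (k : nat) y : y != 0 -> v y = k%:Z -> w y = v y * w pi.
    move=> y0 vy; have pik : pi ^+ k != 0 by rewrite expf_neq0.
    have : w (y / pi ^+ k) = 0.
      by apply: eq0; rewrite dvalM ?invr_neq0 // dvalV // dvalX // vy vpi; lia.
    by rewrite dvalM ?invr_neq0 // dvalV // dvalX // vy; lia.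
  case vx : (v x) => [k|k]; first by rewrite (key k) ?vx.
  have := key k.+1 x^-1; rewrite invr_neq0 // !dvalV // vx => /(_ isT).
  by rewrite NegzE opprK => /(_ erefl); lia.
have rho0 : rho != 0 by apply/eqP => E; move: wrho; rewrite E dval0.
have wpi : w pi = 1.
  have := hvw pi; rewrite vpi => /(_ isT) wpi.
  have := wE rho rho0; rewrite wrho; move: (w pi) (v rho) wpi => c d c0 E.
  have d1 : 1 <= d by nia.
  by nia.
apply: functional_extensionality => x; have [->|x0] := eqVneq x 0.
  by rewrite !dval0.
by rewrite wE // wpi mulr1.
Qed.

(** Neither valuation ring contains the other; the quotient of two witnesses of this has both signs
    strict. *)
Lemma dval_separate (K : fieldType) (v w : K -> int) :
  is_dval v -> is_dval w -> v <> w -> exists y, 0 < v y /\ w y < 0.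
Proof.
have sep (v1 v2 : K -> int) : is_dval v1 -> is_dval v2 -> v1 <> v2 ->
    exists x, 0 <= v1 x /\ v2 x < 0.
  move=> h1 h2 ne; apply: NNPP => hn; apply: ne; apply: dval_le_eq => // x vx.
  by rewrite leNgt; apply/negP => wx; apply: hn; exists x.
move=> hv hw ne; have [x [vx wx]] := sep v w hv hw ne.
have [y [wy vy]] := sep w v hw hv (fun e => ne (esym e)).
have x0 : x != 0 by apply/eqP => E; move: wx; rewrite E dval0.
have y0 : y != 0 by apply/eqP => E; move: vy; rewrite E dval0.
by exists (x / y); rewrite !dvalM ?invr_neq0 // !dvalV //; lia.
Qed.

Lemma dvalD_lt (K : fieldType) (v : K -> int) x y :
  is_dval v -> x != 0 -> y != 0 -> v x < v y -> x + y != 0 /\ v (x + y) = v x.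
Proof.
move=> hv x0 y0 vxy.
have xy0 : x + y != 0.
  by apply/eqP => /eqP; rewrite addr_eq0 => /eqP E; move: vxy; rewrite E dvalN // ltxx.
split=> //; case: (hv) => _ _ hD _; have h1 := hD x y x0 y0 xy0.
have h2 := hD (x + y) (- y) xy0; rewrite oppr_eq0 addrK dvalN // in h2.
by have := h2 y0 x0; lia.
Qed.

(** Induction on the number of places: [x] serves the earlier ones, [y] separates [v] from the new
    one, and a high power of [x] combines them. *)
Lemma dval_approx (K : fieldType) (v : K -> int) (W : nat -> K -> int) m :
  is_dval v -> (forall j, (j < m)%N -> is_dval (W j) /\ v <> W j) ->
  exists x, 0 < v x /\ forall j, (j < m)%N -> W j x < 0.
Proof.
move=> hv; elim: m => [_|m IH hW].
  have [pi vpi] : exists x, v x = 1 by case: hv.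
  by exists pi; rewrite vpi.
have [x [vx wx]] := IH (fun j jm => hW j (ltnW jm)).
have [hm nem] := hW m (ltnSn m).
have [y [vy wy]] := dval_separate hv hm nem.
have x0 : x != 0 by apply/eqP => E; move: vx; rewrite E dval0.
have y0 : y != 0 by apply/eqP => E; move: vy; rewrite E dval0.
(* Larger than every [|W j y|] for [j < m], so that [x ^+ k] outweighs [y] at all earlier places. *)
pose k := (\sum_(j < m) `|W j y|%N).+1.
have kW j : (j < m)%N -> W j y < k%:Z.
  move=> jm; have : (`|W j y| <= \sum_(j < m) `|W j y|)%N.
    by rewrite (bigD1 (Ordinal jm)) //= leq_addr.
  by rewrite /k; lia.
have [wmx|wmx] := leP (W m x) 0.
  have xk : x ^+ k != 0 by rewrite expf_neq0.
  exists (x ^+ k * y); split=> [|j].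
    by rewrite dvalM // dvalX //; nia.
  rewrite ltnS leq_eqVlt => /orP[/eqP->|jm].
    by rewrite dvalM // dvalX //; nia.
  have [hj _] := hW j (ltnW jm); rewrite dvalM // dvalX //.
  by have := kW j jm; have := wx j jm; nia.
(* Now [x] is positive at both [v] and [W m], so [1 + x ^+ k] is a unit there, while at the earlier
   places it has the valuation of [x ^+ k]. *)
have unit1 w : is_dval w -> 0 < w x -> 1 + x ^+ k != 0 /\ w (1 + x ^+ k) = 0.
  move=> hw wx0; rewrite -(dval1 hw); apply: dvalD_lt; rewrite ?expf_neq0 ?oner_neq0 //.
  by rewrite dval1 // dvalX //; rewrite /k; lia.
have [k0 vk] := unit1 v hv vx.
have [_ wk] := unit1 (W m) hm wmx.
exists (y * (1 + x ^+ k)); split=> [|j].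
  by rewrite dvalM // vk addr0.
rewrite ltnS leq_eqVlt => /orP[/eqP->|jm].
  by rewrite dvalM // wk addr0.
have [hj _] := hW j (ltnW jm).
have xk : x ^+ k != 0 by rewrite expf_neq0.
have lt1 : W j (x ^+ k) < W j 1.
  by rewrite dval1 // dvalX //; have := wx j jm; rewrite /k; nia.
have [_ Ek] := dvalD_lt hj xk (oner_neq0 _) lt1.
rewrite dvalM // addrC addrC [1 + _]addrC Ek dvalX //.
by have := kW j jm; have := wx j jm; nia.
Qed.

(** Take 1/(1 + x) with [x] from [dval_approx]. *)
Lemma dval_approx1 (K : fieldType) (v : K -> int) (W : nat -> K -> int) m :
  is_dval v -> (forall j, (j < m)%N -> is_dval (W j) /\ v <> W j) ->
  exists a, vunit v a /\ forall j, (j < m)%N -> vpos (W j) a.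
Proof.
move=> hv hW; have [x [vx wx]] := dval_approx hv hW.
have x0 : x != 0 by apply/eqP => E; move: vx; rewrite E dval0.
have [x10 v1x] : 1 + x != 0 /\ v (1 + x) = v 1.
  by apply: dvalD_lt; rewrite ?oner_neq0 ?dval1.
exists (1 + x)^-1; split; first by split; rewrite ?invr_neq0 // dvalV // v1x dval1.
move=> j jm; have [hj _] := hW j jm; right.
have lt1 : W j x < W j 1 by rewrite dval1 //; apply: wx.
have [_ E] := dvalD_lt hj x0 (oner_neq0 _) lt1.
by rewrite dvalV // addrC E oppr_gt0; apply: wx.
Qed.

(** * Places above a rational prime *)

(** Integers prime to [p] are units at both places, by Bezout. Hence integrality of [q] at either
    place means that [p] does not divide its denominator: otherwise the numerator would be a unit
    and yet positive. *)
Lemma dval_rat_vint (K : fieldExtType rat) (v w : K -> int) p (q : rat) :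
  prime p -> is_dval v -> is_dval w -> vpos v p%:R -> vpos w p%:R ->
  vint v q%:A -> vint w q%:A.
Proof.
move=> pp hv hw pv pw vq.
have unit_coprime (u : K -> int) (n : int) : is_dval u -> vpos u p%:R ->
    coprime p `|n| -> vunit u n%:~R.
  move=> hu pu cp; apply: vint_unit => //; first exact: vint_int.
  move=> pn; have [a [b]] : exists a b : int, a * p%:Z + b * n = 1.
    have /coprimezP[[a b] /= E] : coprimez p%:Z n by [].
    by exists a, b.
  move/(congr1 (intmul (1 : K))); rewrite rmorphD !rmorphM /= => E.
  have : vpos u 1.
    rewrite -[1]/(1%:~R) -E; apply: vposD => //; rewrite mulrC; apply: vposM => //;
      exact: vint_int.
  by apply: vunitNpos; split; [apply: oner_neq0 | apply: dval1].
have qE : q%:A = (numq q)%:~R / (denq q)%:~R :> K.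
  by rewrite -[q in LHS]divq_num_den -!(rmorph_int (in_alg K)) -(fmorph_div (in_alg K)).
have d0 : (denq q)%:~R != 0 :> K by rewrite intf_neq0 denq_neq0.
have [pd|pd] := boolP (p %| `|denq q|)%N; last first.
  have [_ wd] : vunit w (denq q)%:~R by apply: unit_coprime; rewrite // prime_coprime.
  rewrite qE; apply: vintM => //; first exact: vint_int.
  by right; rewrite dvalV // wd oppr0.
have pd' : vpos v (denq q)%:~R.
  have /dvdzP[c ->] : (p%:Z %| denq q)%Z by [].
  by rewrite rmorphM mulrC; apply: vposM => //; apply: vint_int.
have un : vunit v (numq q)%:~R.
  apply: unit_coprime => //; rewrite prime_coprime //; apply/negP => pn.
  have := coprime_num_den q; rewrite /coprime => /eqP g.
  have : (p %| gcdn `|numq q| `|denq q|)%N by rewrite dvdn_gcd pn pd.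
  by rewrite g dvdn1 => /eqP p1; move: pp; rewrite p1.
case: (vunitNpos un); rewrite -[X in vpos v X](divfK d0) -qE mulrC.
exact: vposM.
Qed.

(* Elements a_i that are units at W_i and vanish at the other W_j are linearly
   independent over Q: in a relation, divide by the coefficient of least
   valuation, which does not depend on the place above p. *)
Lemma dval_above_prime_le (K : fieldExtType rat) p n (W : 'I_n -> K -> int) :
  prime p -> injective W -> (forall i, is_dval (W i) /\ vpos (W i) p%:R) ->
  (n <= \dim {:K})%N.
Proof.
move=> pp injW hW.
have /fin_all_exists[a ha] (i : 'I_n) : exists a,
    vunit (W i) a /\ forall j, j != i -> vpos (W j) a.
  pose s := [seq W j | j <- enum 'I_n & j != i].
  pose V' := nth (W i) s.
  have [j jm|b [ub hb]] := @dval_approx1 K (W i) V' (size s) (proj1 (hW i)).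
    have [k ki ->] : exists2 k, k != i & V' j = W k.
      move: jm; rewrite /V' /s size_map => jm; rewrite (nth_map i) //.
      exists (nth i [seq k <- enum 'I_n | k != i] j) => //.
      by have := mem_nth i jm; rewrite mem_filter => /andP[].
    by split; [apply: (proj1 (hW k)) | move/injW => E; rewrite E eqxx in ki].
  exists b; split=> // j ji.
  have js : j \in [seq k <- enum 'I_n | k != i] by rewrite mem_filter ji mem_enum.
  have := hb (index j [seq k <- enum 'I_n | k != i]); rewrite size_map index_mem js.
  by move=> /(_ isT); rewrite /V' (nth_map i) ?index_mem // nth_index.
suff fa : free [tuple a i | i < n].
  by rewrite -(size_tuple [tuple a i | i < n]) -(eqnP fa) dimvS ?subvf.
apply/freeP => k ksum i0; apply/eqP; apply/negPn/negP => ki0.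
have sum0 : \sum_(i < n) k i *: a i = 0.
  by rewrite -[RHS]ksum; apply: eq_bigr => i _; rewrite -tnth_nth tnth_mktuple.
have [i1 ki1 imin] : exists2 i, k i != 0 & forall j, k j != 0 ->
    (W i0 (k i)%:A <= W i0 (k j)%:A).
  case: (@arg_minP _ _ _ i0 (fun i => k i != 0) (fun i => W i0 (k i)%:A) ki0).
  by move=> i1 h1 h2; exists i1.
have [h1 p1] := hW i1; have [h0 p0] := hW i0.
have [u1 _] := ha i1; apply: (vunitNpos u1).
have -> : a i1 = - \sum_(j < n | j != i1) (k j / k i1)%:A * a j.
  move: sum0; rewrite (bigD1 i1) //= => /eqP; rewrite addr_eq0 => /eqP E.
  have -> : a i1 = (k i1)^-1 *: (k i1 *: a i1) by rewrite scalerA mulVf ?scale1r.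
  rewrite E scalerN scaler_sumr; congr (- _); apply: eq_bigr => j _.
  by rewrite scalerA mulr_algl mulrC.
apply: vposN => //; apply: vpos_sum => // j ji.
rewrite mulrC; apply: vposM => //; first by case: (ha j) => _; apply; rewrite eq_sym.
apply: (dval_rat_vint pp h0 h1 p0 p1).
have [->|kj0] := eqVneq (k j) 0; first by rewrite mul0r scale0r; left.
right; have nz c : c != 0 -> c%:A != 0 :> K by move=> c0; rewrite scaler_eq0 negb_or c0 oner_neq0.
have -> : (k j / k i1)%:A = (k j)%:A / (k i1)%:A :> K by rewrite -(fmorph_div (in_alg K)).
rewrite dvalM ?invr_neq0 ?nz // dvalV // subr_ge0.
exact: imin.
Qed.

(** * Finite sets of places *)

(** Finiteness without decidable equality: an enumeration, possibly with repetitions, in the format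
    used for the places in S. *)
Definition fincover T (P : T -> Prop) :=
  exists n (S : 'I_n -> T), (forall k, P (S k)) /\ forall w, P w -> exists k, S k = w.

(** Starting from the empty family, adjoin a missing element, by classical choice of case, until
    none is left; the bound [d] on injective families stops this. *)
Lemma fincover_bounded T (P : T -> Prop) d :
  (forall n (S : 'I_n -> T), injective S -> (forall k, P (S k)) -> (n <= d)%N) ->
  fincover P.
Proof.
move=> hd.
suff ext m n (S : 'I_n -> T) : (d - n < m)%N -> injective S -> (forall k, P (S k)) ->
    fincover P.
  by apply: (ext d.+1 0%N (fun i : 'I_0 => False_rect T (notF (ltn_ord i))));
    rewrite ?ltnS ?leq_subr // => -[].
elim: m n S => // m IH n S hm injS hS.
have [hcov|/not_all_ex_not[w hw]] := classic (forall w, P w -> exists k, S k = w).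
  by exists n, S.
have [Pw nw] := imply_to_and _ _ hw.
pose S' (i : 'I_n.+1) := if unlift ord0 i is Some j then S j else w.
have nd := hd n S injS hS.
have injS' : injective S'.
  move=> i j; rewrite /S'.
  case: (unliftP ord0 i) => [i'|] ->; case: (unliftP ord0 j) => [j'|] -> //.
  - by move/injS=> ->.
  - by move=> E; case: nw; exists i'.
  - by move=> E; case: nw; exists j'.
have PS' k : P (S' k) by rewrite /S'; case: unlift.
have := hd _ S' injS' PS' => nd1.
by apply: (IH _ S') => //; lia.
Qed.

Lemma fincoverU T (P Q : T -> Prop) : fincover P -> fincover Q ->
  fincover (fun w => P w \/ Q w).
Proof.
move=> [n [S [hS cS]]] [m [S2 [hS2 cS2]]].
exists (n + m)%N, (fun k => match split k with inl i => S i | inr j => S2 j end).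
split=> [k|w [/cS[k <-]|/cS2[k <-]]]; first by case: split => i; [left | right].
  by exists (lshift m k); rewrite -[lshift m k]/(unsplit (inl k)) unsplitK.
by exists (rshift n k); rewrite -[rshift n k]/(unsplit (inr k)) unsplitK.
Qed.

(** [P] is not decidable, so the enumeration of [Q] cannot be filtered; it is used to bound
    injective families in [P] instead. *)
Lemma fincoverS T (P Q : T -> Prop) : (forall w, P w -> Q w) -> fincover Q -> fincover P.
Proof.
move=> PQ [n [S [hS cS]]]; apply: (@fincover_bounded _ _ n) => m S' injS' hS'.
have /fin_all_exists[f fE] (i : 'I_m) : exists k, S k = S' i by apply: cS; apply: PQ.
have injf : injective f by move=> i j fij; apply: injS'; rewrite -!fE fij.
by have := leq_card f injf; rewrite !card_ord.
Qed.

(** Split off a prime factor [p]: a place dividing [n] divides [p] or [n %/ p], and at most [K : Q]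
    places divide [p]. *)
Lemma fincover_dval_nat (K : fieldExtType rat) n : (0 < n)%N ->
  fincover (fun w : K -> int => is_dval w /\ vpos w n%:R).
Proof.
elim/ltn_ind: n => n IH n0.
have [n1|n1] := leqP n 1.
  apply: (@fincover_bounded _ _ 0) => -[//|m] S _ hS; have [h0 p0] := hS ord0.
  have nE : n = 1%N by lia.
  case: (@vunitNpos K (S ord0) 1) => //; last by rewrite nE in p0.
  by split; [apply: oner_neq0 | apply: dval1].
have pp := pdiv_prime n1; set p := pdiv n in pp.
have nE : n = (p * (n %/ p))%N by rewrite mulnC divnK ?pdiv_dvd.
have q0 : (0 < n %/ p)%N by move: n0; rewrite [X in (0 < X)%N]nE muln_gt0 => /andP[].
have qn : (n %/ p < n)%N by rewrite ltn_Pdiv ?prime_gt1.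
apply: fincoverS (fincoverU (Q := fun w => is_dval w /\ vpos w p%:R) (IH _ qn q0) _).
  move=> w [hw]; rewrite [X in vpos w X%:R]nE natrM => pw.
  apply: NNPP => /not_or_and[np nq]; apply: (vunitNpos _ pw).
  apply: vunitM => //; apply: vint_unit => //; try exact: vint_nat.
    by move=> h; apply: nq.
  by move=> h; apply: np.
apply: (@fincover_bounded _ _ (\dim {:K})) => m S injS hS.
exact: dval_above_prime_le pp injS hS.
Qed.

Lemma fincover_dval_neq0 (K : fieldExtType rat) (x : K) : x != 0 ->
  fincover (fun w : K -> int => is_dval w /\ ~ vunit w x).
Proof.
move=> x0; have [n n0 hn] := dval_pos_nat x0.
have [m m0 hm] := dval_pos_nat (invr_neq0 x0).
apply: fincoverS (fincoverU (fincover_dval_nat K n0) (fincover_dval_nat K m0)).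
move=> w [hw nu]; have wx : w x != 0 by apply/eqP => wx; apply: nu.
have [wx0|wx0] := leP (w x) 0; [right|left]; split=> //.
  by apply: hm => //; right; rewrite dvalV //; lia.
by apply: hn => //; right.
Qed.

(** Zero entries are passed over, because coefficients of the data may vanish and 0 is integral at
    every place. *)
Lemma fincover_dval_seq (K : fieldExtType rat) (s : seq K) :
  fincover (fun w : K -> int => is_dval w /\
    exists c, [/\ c \in s, c != 0 & ~ vunit w c]).
Proof.
elim: s => [|c s IH].
  by apply: (@fincover_bounded _ _ 0) => -[//|m] S _ /(_ ord0)[_ [c []]].
have [c0|c0] := eqVneq c 0.
  apply: fincoverS IH => w [hw [d [ds d0 nu]]]; split=> //; exists d; split=> //.
  by move: ds; rewrite inE => /predU1P[dE|//]; rewrite dE c0 eqxx in d0.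
apply: fincoverS (fincoverU IH (fincover_dval_neq0 c0)) => w [hw [d [ds d0 nu]]].
move: ds; rewrite inE => /predU1P[dE|ds]; first by right; rewrite -dE.
by left; split=> //; exists d.
Qed.

(** * Powers of 2, and polynomials vanishing on them *)

(** Places dividing [E] divide a fixed natural number, and even its odd part [m] when 2 is a unit;
    by Euler's theorem [M] can be the totient of [m]. *)
Lemma dval_two_pow (K : fieldExtType rat) (E : K) : E != 0 ->
  exists2 M : nat, (0 < M)%N &
    forall w, is_dval w -> vunit w 2%:R -> vpos w E -> vpos w (2%:R ^+ M - 1).
Proof.
move=> E0; have [n n0 hn] := dval_pos_nat E0.
have [m cm nE] := pfactor_coprime (isT : prime 2) n0.
have m0 : (0 < m)%N by move: n0; rewrite nE muln_gt0 => /andP[].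
exists (totient m) => [|w hw u2 pE]; first by rewrite totient_gt0.
have pm : vpos w m%:R.
  have := hn w hw pE; rewrite nE natrM natrX mulrC; apply: vposMV => //.
  exact: vunitX.
have /eqP := cyclic.Euler_exp_totient cm.
rewrite eqn_mod_dvd ?expn_gt0 // => /dvdnP[q qE].
rewrite -natrX -[X in _ - X]/(1%:R) -natrB ?expn_gt0 // qE natrM mulrC.
by apply: vposM => //; apply: vint_nat.
Qed.

(** In characteristic 0 the progression has more distinct terms than [q] can have roots. *)
Lemma poly_powers2_eq0 (K : fieldExtType rat) (q : {poly K}) (e : K) k :
  e != 0 -> (0 < k)%N -> (forall c, q.[e * (2%:R ^+ k) ^+ c] = 0) -> q = 0.
Proof.
move=> e0 k0 hq; apply/eqP/negPn/negP => q0.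
pose f c : K := e * (2%:R ^+ k) ^+ c.
have injf : injective f.
  move=> c d /(mulfI e0)/eqP; rewrite -!natrX natf_eq eqn_exp2l ?(ltn_exp2l 0 k) //.
  by move/eqP.
have := max_poly_roots (rs := map f (iota 0 (size q))) q0.
rewrite size_map size_iota ltnn map_inj_uniq // iota_uniq => H.
by suff /H/(_ isT) : all (root q) (map f (iota 0 (size q))) by [];
   apply/allP => _ /mapP[c _ ->]; apply/rootP/hq.
Qed.

Lemma meval_poly_subst (K : comNzRingType) n (P : {mpoly K[n]}) (L : 'I_n -> {poly K}) :
  exists q : {poly K}, forall s, q.[s] = P.@[fun k => (L k).[s]].
Proof.
exists (\sum_(m <- msupp P) P@_m *: \prod_i L i ^+ m i) => s.
rewrite horner_sum mevalE; apply: eq_bigr => m _.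
by rewrite hornerZ horner_prod; congr (_ * _); apply: eq_bigr => i _; rewrite horner_exp.
Qed.

(** The digit of index 0 is the remainder modulo [d]; the others follow by induction from the
    quotient. *)
Lemma base_expansion_inj d n (f g : 'I_n -> nat) :
  (forall i, (f i < d)%N) -> (forall i, (g i < d)%N) ->
  (\sum_(i < n) f i * d ^ i = \sum_(i < n) g i * d ^ i)%N -> f =1 g.
Proof.
elim: n f g => [|n IH] f g hf hg; first by move=> _ [].
have split_d (h : 'I_n.+1 -> nat) : (\sum_(i < n.+1) h i * d ^ i =
    (\sum_(i < n) h (lift ord0 i) * d ^ i) * d + h ord0)%N.
  rewrite big_ord_recl expn0 muln1 addnC big_distrl /=; congr (_ + _)%N.
  by apply: eq_bigr => i _; rewrite expnSr mulnA.
rewrite !split_d => E.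
have E0 : f ord0 = g ord0.
  by have := congr1 (modn^~ d) E; rewrite /= !modnMDl !modn_small.
move: E; rewrite E0 => /addIn /eqP; rewrite eqn_pmul2r; last by apply: leq_ltn_trans (hf ord0).
move=> /eqP /IH E i; case: (unliftP ord0 i) => [j|] -> //.
by apply: E.
Qed.

(* Kronecker substitution [x_i = s ^ (d ^ i)]. *)
Lemma meval_eq0 (K : fieldExtType rat) n (P : {mpoly K[n]}) :
  (forall x, P.@[x] = 0) -> P = 0.
Proof.
move=> hP; apply/eqP/negPn/negP => P0.
(* Exceeds all exponents occurring in [P], so [kap] separates the monomials of the support. *)
pose d := (\sum_(m <- msupp P) mdeg m).+1.
have hd m i : m \in msupp P -> (m i < d)%N.
  move=> mP; rewrite ltnS (big_rem m) //=; apply: leq_trans (leq_addr _ _).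
  by rewrite mdegE (bigD1 i) //= leq_addr.
pose kap (m : 'X_{1..n}) := (\sum_(i < n) m i * d ^ i)%N.
pose q : {poly K} := \sum_(m <- msupp P) P@_m *: 'X^(kap m).
have q0 : q = 0.
  apply: (@poly_powers2_eq0 _ _ 1 1%N) => // [|c]; first exact: oner_neq0.
  set s := 1 * _; rewrite -[RHS](hP (fun i => s ^+ (d ^ i))) mevalE horner_sum.
  apply: eq_bigr => m _; rewrite hornerZ hornerXn -prodrXr; congr (_ * _).
  by apply: eq_bigr => i _; rewrite -exprM mulnC.
have /eqP : size (msupp P) != 0%N by rewrite size_eq0 msupp_eq0.
case sP : (msupp P) => [|m0 s] // _.
have m0P : m0 \in msupp P by rewrite sP mem_head.
have := congr1 (fun r : {poly K} => r`_(kap m0)) q0.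
rewrite coef0 coef_sum (bigD1_seq m0) ?msupp_uniq //= coefZ coefXn eqxx mulr1.
rewrite big_seq_cond big1 => [|m /andP[mP mm0]].
  by rewrite addr0 => /eqP; rewrite mcoeff_eq0 m0P.
rewrite coefZ coefXn; case: eqP => [E|]; last by rewrite mulr0.
case/eqP: mm0; apply/mnmP; apply: (base_expansion_inj (d := d)) => // i; exact: hd.
Qed.

(** * Integral forms and reduction to [D] *)

Lemma vint_coefM (K : fieldType) (v : K -> int) n (f g : {mpoly K[n]}) : is_dval v ->
  (forall m, vint v f@_m) -> (forall m, vint v g@_m) -> forall m, vint v (f * g)@_m.
Proof.
by move=> hv hf hg m; rewrite mcoeffM; apply: vint_sum => // k _; apply: vintM.
Qed.

Lemma vint_coef_prod (K : fieldType) (v : K -> int) n I (s : seq I)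
    (F : I -> {mpoly K[n]}) : is_dval v ->
  (forall i m, vint v (F i)@_m) -> forall m, vint v (\prod_(i <- s) F i)@_m.
Proof.
move=> hv hF; pose T (f : {mpoly K[n]}) := forall m, vint v f@_m.
apply: (big_ind T) => [|f g|i _]; [|exact: vint_coefM|exact: hF].
by move=> m; rewrite mcoeff1; case: (_ == _); [apply: vint1 | apply: vint0].
Qed.

Lemma vint_coef_linform (K : fieldType) (v : K -> int) (h : 'I_4 -> K) : is_dval v ->
  (forall i, vint v (h i)) -> forall m, vint v (linform h)@_m.
Proof.
move=> hv hh m; rewrite /linform raddf_sum; apply: vint_sum => // i _.
rewrite /= mcoeffZ mcoeffX; apply: vintM => //.
by case: (_ == _); [apply: vint1 | apply: vint0].
Qed.

Lemma meval_linform (K : fieldType) (h x : 'I_4 -> K) : (linform h).@[x] = linval h x.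
Proof.
by rewrite /linform raddf_sum; apply: eq_bigr => i _; rewrite /= mevalZ mevalXU.
Qed.

Lemma linformD (K : fieldType) (c d : K) (a b : 'I_4 -> K) :
  linform (fun k => c * a k + d * b k) = c *: linform a + d *: linform b.
Proof.
rewrite /linform !scaler_sumr -big_split; apply: eq_bigr => i _ /=.
by rewrite scalerDl !scalerA.
Qed.

Lemma vint_linval (K : fieldType) (v : K -> int) (h x : 'I_4 -> K) : is_dval v ->
  (forall i, vint v (h i)) -> (forall i, vint v (x i)) -> vint v (linval h x).
Proof. by move=> hv hh hx; apply: vint_sum => // i _; apply: vintM. Qed.

(** The witness is the product of the four plane forms and, for each line, one integral combination
    of its two equations: it lies in the ideal, has integral coefficients and is a unit at [x]. *)
Lemma not_reduces_to_D (K : fieldType) (w : K -> int) (hs : 'I_4 -> 'I_4 -> K) r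
    (ls : 'I_r -> ('I_4 -> K) * ('I_4 -> K)) (x : 'I_4 -> K) : is_dval w ->
  (forall i k, vint w (hs i k)) -> (forall k, vint w (x k)) ->
  (forall j k, vint w ((ls j).1 k) /\ vint w ((ls j).2 k)) ->
  (forall i, vunit w (linval (hs i) x)) ->
  (forall j, exists c d, [/\ vint w c, vint w d &
     vunit w (c * linval (ls j).1 x + d * linval (ls j).2 x)]) ->
  ~ reduces_to w (D_ideal hs ls) x.
Proof.
move=> hw ihs ix ils uh ul red.
(* If all coordinates were positive, so would be the unit [linval (hs ord0) x]. *)
have nx : vnormalized w x.
  split=> //; apply: NNPP => hn; apply: (vunitNpos (uh ord0)).
  apply: vpos_sum => // i _; rewrite mulrC; apply: vposM => //.
  apply: NNPP => np; apply: hn; exists i; exact: vint_unit.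
have /fin_all_exists2[cd icd ucd] (j : 'I_r) : exists2 cd : K * K,
    vint w cd.1 /\ vint w cd.2 &
    vunit w (cd.1 * linval (ls j).1 x + cd.2 * linval (ls j).2 x).
  by have [c [d [ic id_ u]]] := ul j; exists (c, d).
pose l j := (cd j).1 *: linform (ls j).1 + (cd j).2 *: linform (ls j).2.
pose f := (\prod_i linform (hs i)) * \prod_j l j.
have uf : vunit w f.@[x].
  rewrite mevalM !rmorph_prod /=; apply: vunitM => //; apply: vunit_prod => // i _.
    by rewrite meval_linform.
  by rewrite mevalD !mevalZ !meval_linform.
apply: (vunitNpos uf); apply: (red x) => //.
- by exists 1; split=> [|i]; rewrite ?oner_neq0 ?mul1r.
- split=> [i|j].
    exists ((\prod_(k | k != i) linform (hs k)) * \prod_j l j).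
    by rewrite /f (bigD1 i) //= [linform _ * _]mulrC mulrAC.
  pose g := (\prod_i linform (hs i)) * \prod_(k | k != j) l k.
  exists ((cd j).1 *: g), ((cd j).2 *: g).
  have -> : f = g * l j by rewrite /f /g (bigD1 j) //= [l j * _]mulrC mulrA.
  by rewrite /l mulrDr -!scalerAr -!scalerAl.
- apply: vint_coefM => //; apply: vint_coef_prod => // i; first exact: vint_coef_linform.
  have [ic id_] := icd i; rewrite /l -linformD; apply: vint_coef_linform => // k.
  by have [i1 i2] := ils i k; apply: vintD => //; apply: vintM.
Qed.

Lemma S_integralZ (L : fieldType) n (S : 'I_n -> L -> int) I (x : 'I_4 -> L) c :
  c != 0 -> S_integral S I x -> S_integral S I (fun i => c * x i).
Proof.
move=> c0 [[i xi] hx]; split; first by exists i; rewrite mulf_neq0.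
move=> w hw nS red; apply: (hx w hw nS) => y [d [d0 yE]] ny f If cf.
apply: (red y) => //; exists (d / c); split=> [|k]; first by rewrite mulf_neq0 ?invr_neq0.
by rewrite yE mulrA divfK.
Qed.

(** * Avoiding a line through the common point *)

(** The minors [m] are the Plücker coordinates of the line. Eliminating the coordinate [i1] or [i0]
    from [a], [b] gives forms A, B whose coefficients are minors; both vanish at [p], so they may be
    evaluated at [y - p], whose coordinate [i3] is 0, and two terms remain in each. *)
Lemma line_forms_unit (K : fieldType) (w : K -> int) (a b p : 'I_4 -> K)
    (m := fun k l => a k * b l - a l * b k) (e t u : K) n
    (i0 i1 i2 i3 : 'I_4) (y : 'I_4 -> K) :
  (forall F : 'I_4 -> K, \sum_i F i = F i0 + F i1 + F i2 + F i3) ->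
  is_dval w -> (forall i, vint w (a i) /\ vint w (b i)) ->
  linval a p = 0 -> linval b p = 0 ->
  vint w (p i1) -> vunit w (p i2) -> vunit w e -> vunit w (e - p i0) ->
  vunit w (m i0 i1) -> vunit w (m i2 i0) -> vunit w t -> vint w u ->
  y i0 = e * t ^+ n -> y i1 = p i1 * u -> y i2 = p i2 * t -> y i3 = p i3 ->
  (vpos w (m i0 i1 * (y i0 - p i0) + m i2 i1 * (y i2 - p i2)) -> vpos w (u - 1)) ->
  exists c d, [/\ vint w c, vint w d & vunit w (c * linval a y + d * linval b y)].
Proof.
move=> sumE hw iab ap bp ip1 up2 ue ue0 um01 um20 ut iu y0 y1 y2 y3 hu.
have im k l : vint w (m k l).
  have [ik jk] := iab k; have [il jl] := iab l.
  by apply: vintD; [|apply: vintM|apply: vintN => //; apply: vintM].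
have linB c d : c * linval a y + d * linval b y =
    c * (linval a y - linval a p) + d * (linval b y - linval b p).
  by rewrite ap bp !subr0.
have [it ie] := (vunit_int ut, vunit_int ue).
have uA_B : vunit w (m i0 i1 * (y i0 - p i0) + m i2 i1 * (y i2 - p i2)) \/
    vunit w (m i1 i0 * (y i1 - p i1) + m i2 i0 * (y i2 - p i2)).
  have it1 : vint w (t - 1) by apply: vintD => //; apply: vintN => //; apply: vint1.
  have y2E : y i2 - p i2 = (t - 1) * p i2 by rewrite y2; ring.
  have [pt|npt] := classic (vpos w (t - 1)).
    left; apply: vunitD => //.
      apply: vunitM => //; rewrite y0.
      have -> : e * t ^+ n - p i0 = e - p i0 + (t ^+ n - 1) * e by ring.
      by apply: vunitD => //; apply: vposM => //; apply: vpos_subX1.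
    rewrite mulrC y2E; apply: vposM => //; apply: vposM => //.
    exact: vunit_int.
  have ut1 := vint_unit it1 npt.
  have [pA|npA] := classic (vpos w (m i0 i1 * (y i0 - p i0) + m i2 i1 * (y i2 - p i2))).
    right; rewrite addrC; apply: vunitD => //.
      by apply: vunitM => //; rewrite y2E; apply: vunitM.
    rewrite y1; have -> : p i1 * u - p i1 = (u - 1) * p i1 by ring.
    by rewrite mulrC; apply: vposM => //; apply: vposM => //; apply: hu.
  left; apply: vint_unit => //; apply: vintD => //; apply: vintM => //.
    apply: vintD => //; first by rewrite y0; apply: vintM => //; apply: vintX.
    (* Integrality of [p i0] is not a hypothesis; it comes from [e] and [e - p i0]. *)
    have -> : - p i0 = e - p i0 - e by ring.
    by apply: vintD; [| exact: vunit_int | exact: vintN].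
  by rewrite y2E; apply: vintM => //; apply: vunit_int.
(* The coefficients of the elimination are entries of [a] and [b], hence integral. *)
case: uA_B => [uA|uB].
  exists (b i1), (- a i1); have [i1a i1b] := iab i1; split=> //; first exact: vintN.
  move: uA; congr vunit; rewrite linB /linval !sumE /m y3; ring.
exists (b i0), (- a i0); have [i0a i0b] := iab i0; split=> //; first exact: vintN.
move: uB; congr vunit; rewrite linB /linval !sumE /m y3; ring.
Qed.

(** On the coordinate line where only [k] and [l] may be nonzero, the two equations become
    proportional, so they have a common zero there. This turns disjointness from the lines
    [H_i ∩ H_j] into nonvanishing of minors. *)
Lemma singular_minor_kernel (K : fieldType) (a b : 'I_4 -> K) k l : k != l ->
  a k * b l - a l * b k = 0 ->
  exists y, [/\ nzvec y, linval a y = 0, linval b y = 0 &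
    forall i, i != k -> i != l -> y i = 0].
Proof.
move=> kl m0.
pose y s t i : K := if i == k then s else if i == l then t else 0.
have yE (h : 'I_4 -> K) s t : linval h (y s t) = h k * s + h l * t.
  rewrite /linval (bigD1 k) //= (bigD1 l) ?(eq_sym l) //= big1 => [|i /andP[ik il]].
    by rewrite /y !eqxx (eq_sym l) (negPf kl) addr0.
  by rewrite /y (negPf ik) (negPf il) mulr0.
have y0 s t i : i != k -> i != l -> y s t i = 0 by rewrite /y => /negPf-> /negPf->.
have nzy s t : s != 0 \/ t != 0 -> nzvec (y s t).
  by case=> h; [exists k | exists l]; rewrite /y ?eqxx // (eq_sym l) (negPf kl).
have [a0|] := boolP ((a k == 0) && (a l == 0)).
  case/andP: a0 => /eqP ak /eqP al.
  have [b0|] := boolP ((b k == 0) && (b l == 0)).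
    case/andP: b0 => /eqP bk /eqP bl; exists (y 1 0); split; last exact: y0.
    - by apply: nzy; left; apply: oner_neq0.
    - by rewrite yE ak al !mul0r addr0.
    - by rewrite yE bk bl !mul0r addr0.
  rewrite negb_and => /orP nb; exists (y (- b l) (b k)); split; last exact: y0.
  - by apply: nzy; rewrite oppr_eq0; case: nb; [right | left].
  - by rewrite yE ak al !mul0r addr0.
  - by rewrite yE; ring.
rewrite negb_and => /orP na; exists (y (- a l) (a k)); split; last exact: y0.
- by apply: nzy; rewrite oppr_eq0; case: na; [right | left].
- by rewrite yE; ring.
- by rewrite yE -[RHS]m0; ring.
Qed.

(** * Coordinates and density *)

Definition vec4 (T : pzSemiRingType) (z0 z1 z2 z3 : T) (i : 'I_4) : T :=
  [:: z0; z1; z2; z3]`_i.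

(** Iterated [lift]s are the form in which [big_ord_recl] and [unliftP] produce indices. *)
Definition idx1 : 'I_4 := lift ord0 ord0.
Definition idx2 : 'I_4 := lift ord0 (lift ord0 ord0).
Definition idx3 : 'I_4 := lift ord0 (lift ord0 (lift ord0 ord0)).

Lemma sum_ord4 (K : fieldType) (F : 'I_4 -> K) :
  \sum_i F i = F ord0 + F idx1 + F idx2 + F idx3.
Proof. by rewrite !big_ord_recl big_ord0 addr0 !addrA. Qed.

Lemma ord4P (P : 'I_4 -> Prop) : P ord0 -> P idx1 -> P idx2 -> P idx3 -> forall i, P i.
Proof.
move=> h0 h1 h2 h3 i; case: (unliftP ord0 i) => [j|] -> //.
case: (unliftP ord0 j) => [k|] -> //; case: (unliftP ord0 k) => [l|] -> //.
by rewrite (ord1 l).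
Qed.

Lemma sum_mul_exchange (K : fieldType) (h : 'I_4 -> K) (B : 'I_4 -> 'I_4 -> K) y :
  \sum_k h k * (\sum_l B k l * y l) = \sum_l (\sum_k h k * B k l) * y l.
Proof.
under eq_bigr do rewrite mulr_sumr.
rewrite exchange_big; apply: eq_bigr => l _; rewrite mulr_suml.
by apply: eq_bigr => k _; rewrite mulrA.
Qed.

Lemma sum_mul_inverse (K : fieldType) (A B : 'I_4 -> 'I_4 -> K) y i :
  (forall k l, \sum_h A k h * B h l = (k == l)%:R) ->
  \sum_k A i k * (\sum_l B k l * y l) = y i.
Proof.
move=> AB; rewrite sum_mul_exchange (bigD1 i) //= AB eqxx mul1r big1 ?addr0 // => l li.
by rewrite AB eq_sym (negPf li) mul0r.
Qed.

Section Density.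
Context (K : fieldExtType rat) (N : 'I_4 -> 'I_4 -> K).

(** For [N] inverse to the matrix of the planes, this recovers x from the values y of the plane
    forms. *)
Definition colcomb (y : 'I_4 -> K) (k : 'I_4) : K := \sum_i N k i * y i.

Lemma meval_vec4_poly (P : {mpoly K[4]}) (l0 l1 l2 l3 : {poly K}) :
  exists q : {poly K}, forall s,
    q.[s] = P.@[colcomb (vec4 l0.[s] l1.[s] l2.[s] l3.[s])].
Proof.
have [q qE] := meval_poly_subst P (fun k => \sum_i N k i *: vec4 l0 l1 l2 l3 i).
exists q => s; rewrite qE; apply: meval_eq => k.
rewrite horner_sum; apply: eq_bigr => i _; rewrite hornerZ; congr (_ * _).
by move: i; apply: ord4P.
Qed.

(** The coordinates 1, 0, 2, 3 are freed one after another: each time a polynomial in one variable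
    vanishes along a geometric progression. The order respects that [M] depends on [l], [a], [b]. *)
Lemma integral_points_dense (P : {mpoly K[4]}) r (c d : 'I_r -> K) (p : 'I_4 -> K) e :
  (forall j, c j != 0) -> e != 0 -> p idx1 != 0 -> p idx2 != 0 -> p idx3 != 0 ->
  (forall (l : K) a b, l != 0 -> (0 < a)%N ->
     (forall j, c j * (e * (2%:R ^+ a) ^+ b - p ord0)
              + d j * (p idx2 * 2%:R ^+ a - p idx2) != 0) ->
     exists2 M, (0 < M)%N & forall n,
       P.@[colcomb (vec4 (l * (e * (2%:R ^+ a) ^+ b)) (l * (p idx1 * (2%:R ^+ M) ^+ n))
                         (l * (p idx2 * 2%:R ^+ a)) (l * p idx3))] = 0) ->
  forall z0 z1 z2 z3, P.@[colcomb (vec4 z0 z1 z2 z3)] = 0.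
Proof.
move=> c0 e0 p1 p2 p3 H.
have two0 : 2%:R != 0 :> K by rewrite (natf_eq K 2 0).
have step1 (l : K) a b z1 : l != 0 -> (0 < a)%N ->
    (forall j, c j * (e * (2%:R ^+ a) ^+ b - p ord0)
             + d j * (p idx2 * 2%:R ^+ a - p idx2) != 0) ->
    P.@[colcomb (vec4 (l * (e * (2%:R ^+ a) ^+ b)) z1
                      (l * (p idx2 * 2%:R ^+ a)) (l * p idx3))] = 0.
  move=> l0 a0 nz; have [M M0 hM] := H l a b l0 a0 nz.
  have [q qE] := meval_vec4_poly P (l * (e * (2%:R ^+ a) ^+ b))%:P 'X
                  (l * (p idx2 * 2%:R ^+ a))%:P (l * p idx3)%:P.
  have := qE z1; rewrite !(hornerC, hornerX) => <-; suff -> : q = 0 by rewrite horner0.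
  apply: (@poly_powers2_eq0 _ _ (l * p idx1) M) => // [|n]; first by rewrite mulf_neq0.
  by rewrite qE !(hornerC, hornerX) -mulrA hM.
have step2 (l : K) a z0 z1 : l != 0 -> (0 < a)%N ->
    P.@[colcomb (vec4 z0 z1 (l * (p idx2 * 2%:R ^+ a)) (l * p idx3))] = 0.
  move=> l0 a0.
  have [q qE] := meval_vec4_poly P 'X z1%:P (l * (p idx2 * 2%:R ^+ a))%:P (l * p idx3)%:P.
  have := qE z0; rewrite !(hornerC, hornerX) => <-; suff -> : q = 0 by rewrite horner0.
  (* At the point [l * (e * (2%:R ^+ a) ^+ b)] this is the quantity required to be nonzero, so
     multiplying [q] by all [f j] takes care of the excluded [b]; [c j != 0] makes [f j] nonzero. *)
  pose f j : {poly K} := (c j / l) *: 'X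
     + (d j * (p idx2 * 2%:R ^+ a - p idx2) - c j * p ord0)%:P.
  have f0 : \prod_j f j != 0.
    apply/prodf_neq0 => j _; apply/eqP => /(congr1 (fun g : {poly K} => g`_1)).
    rewrite coefD coefZ coefX coefC coef0 mulr1 addr0 => /eqP.
    by rewrite mulf_eq0 invr_eq0 (negPf l0) (negPf (c0 j)).
  suff /eqP : q * \prod_j f j = 0 by rewrite mulf_eq0 (negPf f0) orbF => /eqP.
  apply: (@poly_powers2_eq0 _ _ (l * e) a) => // [|b]; first by rewrite mulf_neq0.
  rewrite hornerM -mulrA.
  have [/forallP nz|] := boolP [forall j, c j * (e * (2%:R ^+ a) ^+ b - p ord0)
             + d j * (p idx2 * 2%:R ^+ a - p idx2) != 0].
    by rewrite qE !(hornerC, hornerX) step1 // mul0r.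
  rewrite negb_forall => /existsP[j]; rewrite negbK => /eqP E.
  rewrite (bigD1 j) //= hornerM [X in _ * (X * _)](_ : _ = 0) ?mul0r ?mulr0 //.
  by rewrite hornerD hornerZ hornerX hornerC -[RHS]E; field.
have step3 (l : K) z0 z1 z2 : l != 0 -> P.@[colcomb (vec4 z0 z1 z2 (l * p idx3))] = 0.
  move=> l0; have [q qE] := meval_vec4_poly P z0%:P z1%:P 'X (l * p idx3)%:P.
  have := qE z2; rewrite !(hornerC, hornerX) => <-; suff -> : q = 0 by rewrite horner0.
  (* The extra factor 2 turns the exponent into [n.+1], since [a] must be positive. *)
  apply: (@poly_powers2_eq0 _ _ (l * p idx2 * 2%:R) 1) => // [|n].
    by rewrite mulf_neq0 // mulf_neq0.
  by rewrite qE !(hornerC, hornerX) expr1 -!mulrA -exprS step2.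
move=> z0 z1 z2 z3.
have [q qE] := meval_vec4_poly P z0%:P z1%:P z2%:P 'X.
have := qE z3; rewrite !(hornerC, hornerX) => <-; suff -> : q = 0 by rewrite horner0.
(* Here the scaling factor [l] runs through the powers of 2. *)
apply: (@poly_powers2_eq0 _ _ (p idx3) 1) => // n.
by rewrite qE !(hornerC, hornerX) mulrC step3 // expf_neq0.
Qed.

End Density.

(** * Integral points over K when only the first plane may contain the common point *)

Lemma integral_points_zariski_dense (K : fieldExtType rat)
    (nS : nat) (S : 'I_nS -> K -> int) (HS : forall k, is_dval (S k))
    (hs : 'I_4 -> 'I_4 -> K)
    (Hgen : \det (\matrix_(i < 4, j < 4) hs i j) != 0)
    (r : nat) (ls : 'I_r -> ('I_4 -> K) * ('I_4 -> K))
    (p : 'I_4 -> K) (Hp : forall i, i != ord0 -> linval (hs i) p != 0)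
    (Hpl : forall j, linval (ls j).1 p = 0 /\ linval (ls j).2 p = 0)
    (Hdisj : forall j (i1 i2 : 'I_4), i1 != i2 -> forall x : 'I_4 -> K, nzvec x ->
        ~ [/\ linval (ls j).1 x = 0, linval (ls j).2 x = 0,
              linval (hs i1) x = 0 & linval (hs i2) x = 0]) :
  exists nS' (S' : 'I_nS' -> K -> int),
    [/\ forall k, is_dval (S' k), forall k, exists k', S' k' = S k &
        zariski_dense (S_integral S' (D_ideal hs ls))].
Proof.
pose M := \matrix_(i < 4, j < 4) hs i j; pose N i j := invmx M i j.
have Mu : M \in unitmx by rewrite unitmxE unitfE.
have KX i y : linval (hs i) (colcomb N y) = y i.
  by apply: (sum_mul_inverse (A := hs)) => k l; have /matrixP/(_ k l) := mulmxV Mu;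
     rewrite !mxE => <-; apply: eq_bigr => h _; rewrite !mxE.
have XK x : colcomb N (fun i => linval (hs i) x) = x.
  apply: functional_extensionality => k.
  by apply: (sum_mul_inverse (A := N)) => i l; have /matrixP/(_ i l) := mulVmx Mu;
     rewrite !mxE => <-; apply: eq_bigr => h _; rewrite !mxE.
(* The coefficients of the form [h] in the coordinates y. *)
pose pull (h : 'I_4 -> K) i := linval h (fun k => N k i).
have pullE h y : linval h (colcomb N y) = linval (pull h) y by apply: sum_mul_exchange.
pose q i := linval (hs i) p.
have qX : colcomb N q = p by apply: XK.
pose a j := pull (ls j).1; pose b j := pull (ls j).2.
pose m j k l := a j k * b j l - a j l * b j k.
(* A vanishing minor would give a point of the line [j] on [H_i1 ∩ H_i2], where [i1], [i2] are the
   indices other than [k], [l]. *)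
have m_neq0 j k l i1 i2 : k != l -> i1 != i2 -> i1 != k -> i1 != l -> i2 != k -> i2 != l ->
    m j k l != 0.
  move=> kl i12 n1 n2 n3 n4; apply/eqP => /(singular_minor_kernel kl)[y [ny ay by_ y0]].
  apply: (Hdisj j i1 i2 i12 (colcomb N y)); last by split; rewrite ?KX ?y0 // pullE.
  case: ny => i yi; apply: NNPP => nz; case/eqP: yi; rewrite -(KX i y).
  rewrite /linval big1 // => k' _; apply/eqP; rewrite mulf_eq0; apply/orP; right.
  by apply/negPn/negP => h; apply: nz; exists k'.
have two0 : 2%:R != 0 :> K by rewrite (natf_eq K 2 0).
have [e e0 eq0] : exists2 e : K, e != 0 & e - q ord0 != 0.
  have [q1|q1] := eqVneq (q ord0) 1; last by exists 1; rewrite ?oner_neq0 // subr_eq0 eq_sym.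
  by exists 2%:R; rewrite // q1 (_ : 2%:R - 1 = 1) ?oner_neq0 //; ring.
(* Outside the places where a nonzero entry is not a unit, all data and both changes of coordinates
   are integral, and the entries known to be nonzero are units. *)
pose s := codom (fun ik : 'I_4 * 'I_4 => hs ik.1 ik.2)
  ++ codom (fun ik : 'I_4 * 'I_4 => N ik.1 ik.2)
  ++ codom (fun jk : 'I_r * 'I_4 => (ls jk.1).1 jk.2)
  ++ codom (fun jk : 'I_r * 'I_4 => (ls jk.1).2 jk.2)
  ++ codom q ++ [:: 2%:R; e; e - q ord0]
  ++ codom (fun j => m j ord0 idx1) ++ codom (fun j => m j idx2 ord0).
have [n1 [S1 [hS1 cS1]]] := fincover_dval_seq s.
pose S' k := match split k with inl i => S i | inr i => S1 i end.
exists (nS + n1)%N, S'; split=> [k|k|P hP].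
- by rewrite /S'; case: split => i; [apply: HS | apply: (proj1 (hS1 i))].
- by exists (lshift n1 k); rewrite /S' -[lshift n1 k]/(unsplit (inl k)) unsplitK.
apply: meval_eq0 => x; rewrite -(XK x).
rewrite (_ : (fun i => _) = vec4 (linval (hs ord0) x) (linval (hs idx1) x)
   (linval (hs idx2) x) (linval (hs idx3) x)); last first.
  by apply: functional_extensionality; apply: ord4P.
apply: (integral_points_dense (c := fun j => m j ord0 idx1) (d := fun j => m j idx2 idx1)
   (p := q) (e := e)) => // [j||||]; try exact: Hp.
  exact: (@m_neq0 j _ _ idx2 idx3).
move=> l al be l0 al0 nz.
set t := 2%:R ^+ al in nz *.
(* The product over all lines of the values of A, which do not involve u; so one [MM] serves every
   line and every [n]. *)
have E0 : \prod_j (m j ord0 idx1 * (e * t ^+ be - q ord0)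
   + m j idx2 idx1 * (q idx2 * t - q idx2)) != 0 by apply/prodf_neq0 => j _; apply: nz.
have [MM M0 hM] := dval_two_pow E0.
exists MM => // n; set u := _ ^+ n.
pose y := vec4 (e * t ^+ be) (q idx1 * u) (q idx2 * t) (q idx3).
rewrite (_ : colcomb N _ = fun k => l * colcomb N y k); last first.
  apply: functional_extensionality => k; rewrite /colcomb mulr_sumr.
  apply: eq_bigr => i _; rewrite [RHS]mulrCA; congr (_ * _).
  by move: i; apply: ord4P.
apply/hP/S_integralZ => //.
have y_neq0 : y idx3 != 0 by apply: Hp.
split.
  apply: NNPP => nzx; case/eqP: y_neq0; rewrite -(KX idx3 y).
  rewrite /linval big1 // => k' _; apply/eqP; rewrite mulf_eq0; apply/orP; right.
  by apply/negPn/negP => h; apply: nzx; exists k'.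
move=> w hw nS'.
have ws c : c \in s -> c != 0 -> vunit w c.
  move=> cs c0; apply: NNPP => nu.
  have [k kw] := cS1 w (conj hw (ex_intro _ c (And3 cs c0 nu))).
  by apply: (nS' (rshift nS k)); rewrite /S' -[rshift nS k]/(unsplit (inr k)) unsplitK.
have wi c : c \in s -> vint w c.
  by move=> cs; have [->|c0] := eqVneq c 0; [left | apply: vunit_int; apply: ws].
have ihs i k : vint w (hs i k).
  by apply: wi; rewrite !mem_cat (codom_f (fun ik : 'I_4 * 'I_4 => hs ik.1 ik.2) (i, k)) ?orbT.
have iN i k : vint w (N i k).
  by apply: wi; rewrite !mem_cat (codom_f (fun ik : 'I_4 * 'I_4 => N ik.1 ik.2) (i, k)) ?orbT.
have il1 j k : vint w ((ls j).1 k).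
  by apply: wi; rewrite !mem_cat (codom_f (fun jk : 'I_r * 'I_4 => (ls jk.1).1 jk.2) (j, k)) ?orbT.
have il2 j k : vint w ((ls j).2 k).
  by apply: wi; rewrite !mem_cat (codom_f (fun jk : 'I_r * 'I_4 => (ls jk.1).2 jk.2) (j, k)) ?orbT.
have qs i : q i \in s by rewrite !mem_cat (codom_f q i) ?orbT.
have u2 : vunit w 2%:R by apply: ws; rewrite // !mem_cat mem_head ?orbT.
have ue : vunit w e by apply: ws; rewrite // !mem_cat !inE eqxx ?orbT.
have ueq : vunit w (e - q ord0) by apply: ws; rewrite // !mem_cat !inE eqxx ?orbT.
have um01 j : vunit w (m j ord0 idx1).
  apply: ws; last exact: (@m_neq0 j _ _ idx2 idx3).
  by rewrite !mem_cat (codom_f (fun j => m j ord0 idx1) j) ?orbT.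
have um20 j : vunit w (m j idx2 ord0).
  apply: ws; last exact: (@m_neq0 j _ _ idx1 idx3).
  by rewrite !mem_cat (codom_f (fun j => m j idx2 ord0) j) ?orbT.
have uq i : i != ord0 -> vunit w (q i) by move=> i0; apply: ws; rewrite // Hp.
have ut : vunit w t by apply: vunitX.
have uu : vunit w u by apply: vunitX => //; apply: vunitX.
(* These are the values of the plane forms, so the point avoids the four planes. *)
have uy i : vunit w (y i).
  move: i; apply: ord4P; rewrite /y /vec4 /=.
  - by apply: vunitM => //; apply: vunitX.
  - by apply: vunitM => //; apply: uq.
  - by apply: vunitM => //; apply: uq.
  - exact: uq.
apply: not_reduces_to_D => // [k|i|j].
- by apply: vint_sum => // i _; apply: vintM => //; apply: vunit_int.
- by rewrite KX.
have iab j' i : vint w (a j' i) /\ vint w (b j' i) by split; apply: vint_linval.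
rewrite !pullE.
apply: (@line_forms_unit _ w (a j) (b j) q e t u be ord0 idx1 idx2 idx3 y) => //.
- exact: sum_ord4.
- by rewrite /a -pullE qX; case: (Hpl j).
- by rewrite /b -pullE qX; case: (Hpl j).
- exact: wi.
- exact: uq.
- exact: um01.
- exact: um20.
- exact: vunit_int.
(* The other factors of the product are integral, so the whole product is positive at [w], which
   gives [2 ^ MM = 1] and then [u = 1] modulo [w]. *)
move=> pA; apply: vpos_subX1 => //; first by apply: vunit_int; apply: vunitX.
apply: hM => //; rewrite (bigD1 j) //=; apply: vposM => //.
apply: vint_prod => // j' _.
have uint c : vunit w c -> vint w c by apply: vunit_int.
apply: vintD => //; apply: vintM => //.
- exact/uint/um01.
- by apply: vintB => //; [apply: uint; apply: vunitM => //; apply: vunitX | apply: wi].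
- by apply: vintB => //; apply: vintM => //; case: (iab j' idx1) => ? ?; case: (iab j' idx2).
- by apply: vintB => //; [apply: vintM => //; [apply: wi | apply: uint] | apply: wi].
Qed.

(** * Choice of the common point and numbering of the planes *)

Unset Implicit Arguments.

Theorem theorem1p2 (K : fieldExtType rat)
    (nS : nat) (S : 'I_nS -> K -> int) (HS : forall k, is_dval (S k))
    (hs : 'I_4 -> 'I_4 -> K)
    (Hgen : \det (\matrix_(i < 4, j < 4) hs i j) != 0)
    (r : nat) (ls : 'I_r -> ('I_4 -> K) * ('I_4 -> K))
    (Hline : forall j (c d : K), (forall k, c * (ls j).1 k + d * (ls j).2 k = 0) ->
        c = 0 /\ d = 0)
    (p : 'I_4 -> K) (Hp : nzvec p)
    (Hpl : forall j, linval (ls j).1 p = 0 /\ linval (ls j).2 p = 0)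
    (Hdisj : forall j (i1 i2 : 'I_4), i1 != i2 -> forall x : 'I_4 -> K, nzvec x ->
        ~ [/\ linval (ls j).1 x = 0, linval (ls j).2 x = 0,
              linval (hs i1) x = 0 & linval (hs i2) x = 0]) :
  potentially_dense S hs ls.
Proof.
(* With L = K, the only place above [v] is [v] itself. *)
have lies_id (v w : K -> int) : is_dval v -> is_dval w ->
    lies_above (idfun : {rmorphism K -> K}) w v -> v = w.
  move=> hv hw [e [e0 he]]; apply: dval_le_eq => // x vx.
  have [->|x0] := eqVneq x 0; first by rewrite dval0.
  by have := he x x0; rewrite /= => ->; nia.
(* If there is a line, two planes through [p] would meet it at [p], against disjointness. Without
   lines [p] is arbitrary, and a point where all plane forms equal 1 replaces it. *)
have [p' [i0 [Hp' Hpl']]] : exists p' i0, (forall i, i != i0 -> linval (hs i) p' != 0) /\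
    forall j, linval (ls j).1 p' = 0 /\ linval (ls j).2 p' = 0.
  have [j0|r0] := pickP (fun j : 'I_r => true); last first.
    have [x hx] : exists x, forall i, linval (hs i) x = 1.
      have Mu : (\matrix_(i < 4, j < 4) hs i j)^T \in unitmx by rewrite unitmx_tr unitmxE unitfE.
      exists (fun k =>
        ((const_mx 1 : 'rV_4) *m invmx (\matrix_(i < 4, j < 4) hs i j)^T) ord0 k) => i.
      have /matrixP/(_ ord0 i) := mulmxKV Mu (const_mx 1 : 'rV_4).
      rewrite !mxE => E; rewrite -[RHS]E; apply: eq_bigr => k _.
      by rewrite mulrC; congr (_ * _); rewrite !mxE.
    exists x, ord0; split=> [i _|j]; first by rewrite hx oner_neq0.
    by have := r0 j.
  move=> _; have [i0 hi0|hn] := pickP (fun i => linval (hs i) p == 0); last first.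
    by exists p, ord0; split=> // i _; rewrite hn.
  exists p, i0; split=> // i ii0; apply/negP => /eqP hi.
  have [l1 l2] := Hpl j0.
  by apply: (Hdisj j0 i i0 ii0 p Hp); split=> //; apply/eqP.
(* Moves the exceptional plane to index 0; the determinant changes at most by a sign and the ideal
   of [D] stays the same. *)
pose sg := tperm ord0 i0.
have [|i ni|j i1 i2 ni x nx [l1 l2 h1 h2]|nS' [S' [dS' cS' dense]]] :=
    @integral_points_zariski_dense K nS S HS (fun i => hs (sg i)) _ r ls p' _ Hpl' _.
- rewrite (_ : \matrix_(i, j) _ = row_perm sg (\matrix_(i < 4, j < 4) hs i j)).
    by rewrite row_permE det_mulmx mulf_neq0 // det_perm signr_eq0.
  by apply/matrixP => i j; rewrite !mxE.
- by apply: Hp'; apply: contra ni => /eqP E; rewrite -(inj_eq (@perm_inj _ sg)) E tpermL.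
- by apply: (Hdisj j (sg i1) (sg i2) _ x nx); rewrite ?(inj_eq (@perm_inj _ sg)).
exists K, (idfun : {rmorphism K -> K}), nS', S'; split=> //; split=> [k w hw lw|P hP].
  by have [k' k'E] := cS' k; exists k'; rewrite k'E; apply: lies_id.
apply: dense => x [nx hx]; apply: hP; split=> // w hw nw red.
apply: (hx w hw nw) => y cy ny f [fh fl] fi; apply: (red y cy ny f _ fi); split=> // i.
by have := fh (sg i); rewrite /= tpermK.
Qed.
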